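(* Let $\theta\in\mathbb Z^l$ be a weighting, let $\lambda$ be a one-column $l$-multipartition of $n$ and let $\mathfrak t$ and $\mathfrak s$ be $\lambda$-tableaux. Then $d(\mathfrak s)<d(\mathfrak t)$ if and only if $\mathfrak s\lhd_\theta\mathfrak t$, where $<$ is the Bruhat order on $S_n$ with the convention that the identity is the largest element.
   Context: A one-column $l$-multipartition of $n$ is a tuple $\lambda=((1^{a_1}),\dots,(1^{a_l}))$ with integers $a_m\ge 0$, $\sum_m a_m=n$; its diagram is $[\lambda]=\{(r,1,m):1\le m\le l,\ 1\le r\le a_m\}$. A weighting is a tuple $\theta=(\theta_1,\dots,\theta_l)\in\mathbb Z^l$. For $\gamma=(i,j,b)$ and $\gamma'=(i',j',b')$ in $\mathbb N\times\mathbb N\times\{1,\dots,l\}$ write $\gamma\lhd_\theta\gamma'$ if $\theta_b+j-i<\theta_{b'}+j'-i'$, or if $\theta_b+j-i=\theta_{b'}+j'-i'$ and $b>b'$. This order is total on $\mathbb N\times\{1\}\times\{1,\dots,l\}$. For finite sets $A,B\subset\mathbb N\times\mathbb N\times\{1,\dots,l\}$ write $A\unlhd_\theta B$ if $|\{\gamma\in A:\gamma\rhd_\theta\gamma_0\}|\le|\{\gamma\in B:\gamma\rhd_\theta\gamma_0\}|$ for all $\gamma_0\in\mathbb N\times\mathbb N\times\{1,\dots,l\}$. A $\lambda$-tableau is any bijection $\mathfrak t:\{1,\dots,n\}\to[\lambda]$ (not necessarily standard). For $\lambda$-tableaux, $\mathfrak s\unlhd_\theta\mathfrak t$ iff $\mathfrak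 s(\{1,\dots,k\})\unlhd_\theta\mathfrak t(\{1,\dots,k\})$ for all $1\le k\le n$; $\mathfrak s\lhd_\theta\mathfrak t$ means $\mathfrak s\unlhd_\theta\mathfrak t$ and $\mathfrak s\ne\mathfrak t$. $\mathfrak t^\lambda_\theta$ is the $\lambda$-tableau obtained by successively adding, for $i=1,\dots,n$, the node $\mathfrak t_\theta^\lambda(i)$ that is the $\lhd_\theta$-largest node of $[\lambda]$ that can be added to $\{\mathfrak t^\lambda_\theta(1),\dots,\mathfrak t^\lambda_\theta(i-1)\}$ so as to obtain the diagram of a multipartition; equivalently $\mathfrak t^\lambda_\theta(1)\rhd_\theta\cdots\rhd_\theta\mathfrak t^\lambda_\theta(n)$. $S_n$ acts on the right on $\lambda$-tableaux by permuting entries: $\mathfrak t w=\mathfrak t\circ w$, so that $\mathfrak t s_k$ (with $s_k=(k,k+1)$) is obtained by interchanging the entries $k$ and $k+1$. $d(\mathfrak t)\in S_n$ is the unique element with $\mathfrak t_\theta^\lambda\,d(\mathfrak t)=\mathfrak t$. $S_n$ is a Coxeter group with generators $s_1,\dots,s_{n-1}$. *)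

(* Defs.v *)
From HB Require Import structures.
From mathcomp Require Import all_boot all_order all_algebra all_fingroup finmap.
From mathcomp Require Import zify.

Set Implicit Arguments.
Unset Strict Implicit.
Unset Printing Implicit Defensive.

Import Order.TTheory GRing.Theory Num.Theory.

Local Open Scope fset_scope.

(* Rows and columns are numbered from 1; the components 1, ..., l are numbered
   0, ..., l - 1, which does not affect their order. *)
Definition node (l : nat) : Type := (nat * nat * 'I_l)%type.
HB.instance Definition _ l := Choice.on (node l).

(* The multipartition ((1^{a_1}), ..., (1^{a_l})), given by m |-> a_m. *)
Record one_column (l n : nat) := OneColumn {
  column_height :> 'I_l -> nat;
  column_heightP : \sum_m column_height m = n
}.

Definition diagram l (a : 'I_l -> nat) : {fset node l} :=
  [fset x in [seq (r, 1, m) | m <- enum 'I_l, r <- iota 1 (a m)]].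

Definition residue l (theta : 'I_l -> int) (x : node l) : int :=
  (theta x.2 + x.1.2%:Z - x.1.1%:Z)%R.

Definition node_lt l (theta : 'I_l -> int) (x y : node l) : bool :=
  (residue theta x < residue theta y)%R
  || (residue theta x == residue theta y) && (y.2 < x.2).

Definition set_le l (theta : 'I_l -> int) (A B : {fset node l}) : Prop :=
  forall x0 : node l,
    #|` [fset x in A | node_lt theta x0 x]|
      <= #|` [fset x in B | node_lt theta x0 x]|.

(* The column heights of a diagram are bounded by its number of nodes, so that
   being a diagram is decidable; see is_diagramP. *)
Definition is_diagram l (A : {fset node l}) : bool :=
  [exists a : {ffun 'I_l -> 'I_#|` A|.+1}, A == diagram (fun m : 'I_l => a m)].

Definition addable l (A : {fset node l}) (x : node l) : bool :=
  (x \notin A) && is_diagram (x |` A).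

Section Tableaux.
Variables (l n : nat) (lam : one_column l n).

(* The entries 1, ..., n are numbered 0, ..., n - 1. *)
Record tableau := Tableau {
  tableau_fun :> {ffun 'I_n -> diagram lam};
  tableau_bij : injectiveb tableau_fun
                && [forall x : diagram lam, x \in codom tableau_fun]
}.
HB.instance Definition _ := [isSub for tableau_fun].
HB.instance Definition _ := [Choice of tableau by <:].

(* t({1, ..., k}) *)
Definition initial_set (t : tableau) (k : nat) : {fset node l} :=
  [fset val (t i) | i : 'I_n & i < k].

Variable theta : 'I_l -> int.

Definition tableau_le (s t : tableau) : Prop :=
  forall k : nat, 1 <= k <= n ->
    set_le theta (initial_set s k) (initial_set t k).

Definition tableau_lt (s t : tableau) : Prop := tableau_le s t /\ s <> t.

Definition is_dominant (t : tableau) : bool :=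
  [forall i : 'I_n, addable (initial_set t i) (val (t i))
    && [forall x : diagram lam, addable (initial_set t i) (val x) ==>
          (x == t i) || node_lt theta (val x) (val (t i))]].

End Tableaux.

Lemma mem_diagram l (a : 'I_l -> nat) (x : node l) :
  (x \in diagram a) = (1 <= x.1.1 <= a x.2) && (x.1.2 == 1).
Proof.
rewrite /diagram !inE /=; apply/allpairsPdep/idP => [[m [r [_ rP ->]]] /=|].
  by move: rP; rewrite mem_iota eqxx andbT; lia.
case: x => [[r c] m] /= /andP[rP /eqP->].
by exists m, r; split; rewrite ?mem_enum // mem_iota; lia.
Qed.

Lemma card_diagram l (a : 'I_l -> nat) : #|` diagram a| = \sum_m a m.
Proof.
rewrite /diagram card_fseq undup_id; last first.
  apply: allpairs_uniq_dep; rewrite ?enum_uniq //.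
    by move=> m _; rewrite iota_uniq.
  by move=> [m1 r1] [m2 r2] _ _ /= [-> ->].
rewrite size_allpairs_dep sumnE big_map big_enum /=.
by apply: eq_bigr => m _; rewrite size_iota.
Qed.

Lemma is_diagramP l (A : {fset node l}) :
  reflect (exists a : 'I_l -> nat, A = diagram a) (is_diagram A).
Proof.
apply: (iffP existsP) => [[a /eqP->]|[a ->]]; first by exists (fun m => nat_of_ord (a m)).
have lea m : a m < #|` diagram a|.+1.
  by rewrite card_diagram (bigD1 m) //= ltnS leq_addr.
by exists [ffun m => Ordinal (lea m)]; apply/eqP/fsetP=> x; rewrite !mem_diagram ffunE.
Qed.

Section DominantTableau.
Variables (l n : nat) (theta : 'I_l -> int) (lam : one_column l n).

Let ge (x y : diagram lam) := (x == y) || node_lt theta (val y) (val x).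

Lemma node_lt_trans (x y z : node l) :
  node_lt theta x y -> node_lt theta y z -> node_lt theta x z.
Proof.
rewrite /node_lt => /orP[xy|/andP[/eqP-> b]] /orP[yz|/andP[/eqP<- c]].
- by rewrite (lt_trans xy yz).
- by rewrite xy.
- by rewrite yz.
- by rewrite eqxx (ltn_trans c b) orbT.
Qed.

Lemma node_lt_irr (x : node l) : node_lt theta x x = false.
Proof. by rewrite /node_lt ltxx ltnn andbF. Qed.

Lemma node_lt_total (x y : diagram lam) :
  [|| x == y, node_lt theta (val x) (val y) | node_lt theta (val y) (val x)].
Proof.
case: eqVneq => //= nxy; rewrite /node_lt.
case: ltgtP => //= exy; case: ltngtP => //= exy2.
case/eqP: nxy; apply: val_inj => /=.
move: (valP x) (valP y); rewrite !mem_diagram => /andP[_ /eqP cx] /andP[_ /eqP cy].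
have m_eq : (val x).2 = (val y).2 by apply: val_inj.
move: exy; rewrite /residue m_eq cx cy => exy.
have r_eq : (val x).1.1 = (val y).1.1 by move/addrI/oppr_inj: exy => [].
move: m_eq r_eq cx cy => /=; case: (fsval x) (fsval y) => [[? ?] ?] [[? ?] ?] /=.
by move=> -> -> -> ->.
Qed.

Let ge_total : total ge.
Proof.
move=> x y; rewrite /ge; have := node_lt_total x y.
by rewrite [y == x]eq_sym; case: (x == y) => //= /orP[] ->; rewrite ?orbT.
Qed.

Let ge_trans : transitive ge.
Proof.
move=> y x z /orP[/eqP->//|yx] /orP[/eqP<-|zy]; rewrite /ge ?yx ?orbT //.
by rewrite (node_lt_trans zy yx) orbT.
Qed.

Lemma dominant_exists : exists t : tableau lam, is_dominant theta t.
Proof.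
pose e := sort ge (enum {: diagram lam}).
have sz_e : size e == n.
  by rewrite size_sort -cardT -cardfE card_diagram column_heightP.
have e_uniq : uniq e by rewrite sort_uniq enum_uniq.
have e_all x : x \in e by rewrite mem_sort mem_enum.
pose f := [ffun i => tnth (Tuple sz_e) i].
have f_nth x0 i : f i = nth x0 e i by rewrite ffunE (tnth_nth x0).
have f_inj : injective f.
  move=> i j; rewrite (f_nth (f i) i) (f_nth (f i) j) => /eqP.
  by rewrite nth_uniq ?(eqP sz_e) // => /eqP/val_inj.
have f_onto x : exists i, f i = x.
  have := e_all x; rewrite -index_mem (eqP sz_e) => lt_x.
  by exists (Ordinal lt_x); rewrite (f_nth x) /= nth_index.
have f_bij : injectiveb f && [forall x : diagram lam, x \in codom f].
  apply/andP; split; first exact/injectiveP.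
  by apply/forallP=> x; case: (f_onto x) => i <-; apply: codom_f.
exists (Tableau f_bij).
have f_ge (i j : 'I_n) : i < j -> node_lt theta (val (f j)) (val (f i)).
  move=> ij; have : ge (f i) (f j).
    rewrite (f_nth (f i) i) (f_nth (f i) j).
    apply: (sorted_ltn_nth ge_trans) => //; rewrite ?inE ?(eqP sz_e) //.
    exact: sort_sorted ge_total _.
  by case/orP => // /eqP/f_inj/(congr1 val) /=; lia.
have memI (k : nat) j : (val (f j) \in initial_set (Tableau f_bij) k) = (j < k).
  apply/imfsetP/idP => /= [[i ik /val_inj/f_inj ->] //|jk].
  by exists j.
have memD k x : x \in initial_set (Tableau f_bij) k -> exists2 j : 'I_n, j < k & x = val (f j).
  by case/imfsetP => /= j jk ->; exists j.
apply/forallP=> i; apply/andP; split; last first.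
  apply/forallP=> x; apply/implyP => /andP[+ _]; case: (f_onto x) => j <-.
  rewrite memI -leqNgt leq_eqVlt => /orP[/eqP/val_inj->|/f_ge->].
    by rewrite eqxx.
  by rewrite orbT.
apply/andP; split; first by rewrite memI ltnn.
have -> : val (f i) |` initial_set (Tableau f_bij) i = initial_set (Tableau f_bij) i.+1.
  apply/fsetP=> x; rewrite in_fset1U; apply/orP/idP=> [[/eqP->|]|].
  - by rewrite memI.
  - by case/memD=> j ji ->; rewrite memI ltnW.
  - case/memD=> j; rewrite ltnS leq_eqVlt => /orP[/eqP/val_inj-> ->|ji ->]; first by left.
    by right; rewrite memI.
set A := initial_set _ _.
have closed r r' m : 1 <= r' <= r -> (r, 1, m) \in A -> (r', 1, m) \in A.
  move=> rr' /memD[j ji ej].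
  have rD : (r', 1, m) \in diagram lam.
    by move: (valP (f j)); rewrite -ej !mem_diagram /=; lia.
  have [j' ej'] := f_onto [` rD].
  have -> : (r', 1, m) = val (f j') by rewrite ej'.
  rewrite memI; apply: leq_ltn_trans ji; rewrite leqNgt; apply/negP => /f_ge.
  by rewrite -ej ej' /node_lt /residue /=; lia.
have hgt m : exists h, forall r, ((r, 1, m) \in A) = (1 <= r <= h).
  have [h hP] : exists h, forall r, (r, 1, m) \in A -> r <= h.
    exists (lam m) => r /memD[j _ ej].
    by move: (valP (f j)); rewrite -ej mem_diagram /=; lia.
  elim: h hP => [|h IH] hP.
    exists 0 => r; apply/idP/idP; last lia.
    move=> rA; have := hP _ rA; case/memD: rA => j _ ej.
    by move: (valP (f j)); rewrite -ej mem_diagram /=; lia.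
  have [hA|hA] := boolP ((h.+1, 1, m) \in A).
    exists h.+1 => r; apply/idP/idP => [rA|/closed]; last exact.
    rewrite hP // andbT; case/memD: rA => j _ ej.
    by move: (valP (f j)); rewrite -ej mem_diagram /=; lia.
  apply: IH => r rA; have := hP _ rA; rewrite leq_eqVlt => /orP[/eqP er|//].
  by rewrite -er rA in hA.
have [b bP] := fin_all_exists hgt.
apply/is_diagramP; exists b; apply/fsetP => -[[r c] m]; rewrite mem_diagram /=.
have [->|nc] := eqVneq c 1; first by rewrite bP andbT.
rewrite andbF; apply/negP => /memD[j _ ej].
by move: (valP (f j)) nc; rewrite -ej mem_diagram /=; lia.
Qed.

Definition dominant_tableau : tableau lam := xchoose dominant_exists.

Lemma dominant_tableauP : is_dominant theta dominant_tableau.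
Proof. exact: (xchooseP dominant_exists). Qed.

Lemma tableau_inj (t : tableau lam) : injective t.
Proof. by case: t => f /= /andP[/injectiveP]. Qed.

Lemma tableau_onto (t : tableau lam) x : exists i, t i = x.
Proof.
by case: t => f /= /andP[_ /forallP/(_ x)/codomP[i ->]]; exists i.
Qed.

Lemma dominant_unique (t : tableau lam) :
  is_dominant theta t -> t = dominant_tableau.
Proof.
set u := dominant_tableau => /forallP tP; have /forallP uP := dominant_tableauP.
suff tu (k : nat) : k <= n -> forall i : 'I_n, i < k -> t i = u i.
  by apply/val_inj/ffunP => i; apply: (tu n).
elim: k => [//|k IH] kn i; rewrite ltnS leq_eqVlt => /orP[/eqP ik|]; last first.
  by move=> ik; apply: (IH (ltnW kn)).
have eI : initial_set t i = initial_set u i.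
  have eq_tu (j : 'I_n) : j < i -> t j = u j.
    by rewrite ik => jk; apply: (IH (ltnW kn)).
  by apply/fsetP => x; apply/imfsetP/imfsetP => /= -[j ji ->];
    exists j; rewrite ?eq_tu.
have /andP[tA /forallP tM] := tP i; have /andP[uA /forallP uM] := uP i.
have := tM (u i); rewrite eI uA /= => /orP[/eqP->//|lt1].
have := uM (t i); rewrite -eI tA /= => /orP[/eqP->//|lt2].
by have := node_lt_trans lt1 lt2; rewrite node_lt_irr.
Qed.

Lemma tableau_perm_exists (t : tableau lam) :
  exists w : 'S_n, [forall i, dominant_tableau (w i) == t i].
Proof.
have /fin_all_exists[g gP] i := tableau_onto dominant_tableau (t i).
have g_inj : injective g.
  by move=> i j gij; apply: (@tableau_inj t); rewrite -!gP gij.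
by exists (perm g_inj); apply/forallP => i; rewrite permE gP.
Qed.

(* d(t), the unique w with t^lam_theta o w = t. *)
Definition tableau_perm (t : tableau lam) : 'S_n := xchoose (tableau_perm_exists t).

Lemma tableau_permP (t : tableau lam) i :
  dominant_tableau (tableau_perm t i) = t i.
Proof. by have /forallP/(_ i)/eqP := xchooseP (tableau_perm_exists t). Qed.

Lemma tableau_perm_unique (t : tableau lam) (w : 'S_n) :
  (forall i, dominant_tableau (w i) = t i) -> w = tableau_perm t.
Proof.
move=> wP; apply/permP => i; apply: (@tableau_inj dominant_tableau).
by rewrite wP tableau_permP.
Qed.

End DominantTableau.

(* The product u * v of permutations maps i to v (u i), the reverse of
   composition.  Length, reflections and the Bruhat order are invariant under
   inversion, hence do not depend on which of the two products is used. *)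
Section Bruhat.
Variable n : nat.
Local Open Scope group_scope.

Definition simple_transpositions : {set 'S_n} :=
  [set w | [exists i : 'I_n, exists j : 'I_n, (j == i.+1 :> nat) && (w == tperm i j)]].

Definition has_word (w : 'S_n) (k : nat) : bool :=
  [exists c : k.-tuple 'S_n,
    all (mem simple_transpositions) c && (w == \prod_(s <- c) s)].

Lemma gen_simple_transpositions : <<simple_transpositions>> = [set: 'S_n].
Proof.
rewrite /simple_transpositions; case: n => [|m].
  by apply/setP => w; rewrite inE (_ : w = 1) ?group1 //; apply/permP => -[].
set S := [set w | _]; apply/eqP; rewrite eqEsubset subsetT /= -(gen_tperm ord0).
rewrite gen_subG; apply/subsetP => _ /imsetP[[j +] _ ->]; elim: j => [|j IH] jm.
  by rewrite (_ : Ordinal jm = ord0) ?tperm1 ?group1 //; apply: val_inj.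
have jm' := ltnW jm; have sS : tperm (Ordinal jm') (Ordinal jm) \in <<S>>.
  apply/mem_gen; rewrite inE; apply/existsP; exists (Ordinal jm').
  by apply/existsP; exists (Ordinal jm); rewrite !eqxx.
have [j0|j0] := posnP j.
  by rewrite (_ : ord0 = Ordinal jm') //; apply: val_inj; rewrite /= j0.
have -> : tperm ord0 (Ordinal jm)
    = tperm ord0 (Ordinal jm') ^ tperm (Ordinal jm') (Ordinal jm).
  by rewrite tpermJ tpermL tpermD // -val_eqE /=; lia.
by rewrite groupJ // IH.
Qed.

Lemma has_word_exists (w : 'S_n) : exists k, has_word w k.
Proof.
have gen : w \in <<simple_transpositions>>.
  by rewrite gen_simple_transpositions inE.
have [k [c cS ->]] := gen_prodgP gen; exists k; apply/existsP.
exists [tuple c i | i < k]; apply/andP; split.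
  by apply/allP => _ /mapP[i _ ->]; apply: cS.
rewrite big_tuple; apply/eqP; apply: eq_bigr => i _; by rewrite tnth_mktuple.
Qed.

Definition coxeter_length (w : 'S_n) : nat := ex_minn (has_word_exists w).

Definition reflections : {set 'S_n} :=
  class_support simple_transpositions [set: 'S_n].

Definition bruhat_step (u v : 'S_n) : bool :=
  [exists r in reflections, v == u * r] && (coxeter_length u < coxeter_length v).

(* Here the identity is the smallest element. *)
Definition bruhat_le : rel 'S_n := connect bruhat_step.

(* The strict Bruhat order with the identity as largest element. *)
Definition bruhat_lt (u v : 'S_n) : bool := bruhat_le v u && (u != v).

End Bruhat.

(* Main.v *)
Require Import Defs.
From mathcomp Require Import all_boot all_order all_algebra all_fingroup finmap.
From mathcomp Require Import zify.

(** Numbering the nodes of the diagram decreasingly, by means of the dominant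
    tableau, turns tableaux into permutations: the tableau [t] becomes
    [w = tableau_perm theta t], and the number of nodes above the [m]-th one
    among the first [k] entries of [t] becomes
    [rank w k m], the number of [a < k] with [w a < m].  So [s <= t] says that
    [rank (tableau_perm theta s) <= rank (tableau_perm theta t)] at every point
    (lemma [tableau_le_rank]), and the theorem is the rank-matrix criterion for
    the Bruhat order on the symmetric group (lemma [bruhat_le_rank]): going up
    from the identity, whose ranks are the largest, lowers the ranks.

    The criterion needs a combinatorial form of a Bruhat step.  The Coxeter
    length is the number of inversions ([coxeter_lengthE]), and exchanging two
    values that stand in increasing order creates more inversions than it
    destroys ([inversions_tperm]); so a step is exactly such an exchange
    ([bruhat_stepP]).  An exchange lowers the rank by one on a rectangle and
    keeps it elsewhere ([rank_tperm]), whence one implication.  Conversely, if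
    [v] has smaller ranks than [u] and differs from it, then some exchange leads
    from [u] to a permutation whose ranks still dominate those of [v]
    ([rank_le_step]); as the length grows, iterating reaches [v]. *)

Set Implicit Arguments.
Unset Strict Implicit.
Unset Printing Implicit Defensive.

(** * Inversions and the Coxeter length *)

Section Inversions.
Variable n : nat.
Implicit Types (u v w : 'S_n) (i j : 'I_n).
Local Open Scope group_scope.

Definition inversions w : {set 'I_n * 'I_n} :=
  [set p : 'I_n * 'I_n | (p.1 < p.2) && (w p.2 < w p.1)].

Lemma tperm_mul_perm w i j : tperm i j * w = w * tperm (w i) (w j).
Proof. by rewrite -tpermJ /conjg !mulgA mulgV mul1g. Qed.

(** The inversions of [w] inject into those of [tperm i j * w]: relocate the
    pair of values [w a, w b] to its new positions; when this reverses the
    order of the two positions, keep the pair [(a, b)] itself, which remains an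
    inversion because the value at [i] goes up and the value at [j] goes down.
    The new inversion [(i, j)] is missed. *)
Lemma inversions_tperm w i j : i < j -> w i < w j ->
  #|inversions w| < #|inversions (tperm i j * w)|.
Proof.
move=> ij wij; set t := tperm i j.
pose phi (p : 'I_n * 'I_n) := if t p.1 < t p.2 then (t p.1, t p.2) else p.
have phi_inj : {in inversions w &, injective phi}.
  move=> [a b] [c d]; rewrite !inE /phi /= => /andP[ab _] /andP[cd _].
  case: ifP => h1; case: ifP => h2 // [e1 e2].
  - by rewrite (perm_inj e1) (perm_inj e2).
  - by move: h2; rewrite -e1 -e2 !tpermK ab.
  - by move: h1; rewrite e1 e2 !tpermK cd.
rewrite -(card_in_imset phi_inj); apply: proper_card; apply/properP; split.
  apply/subsetP => _ /imsetP[[a b] + ->]; rewrite !inE /phi /= => /andP[ab wab].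
  case: ifP => [h|]; first by rewrite /= h !permM !tpermK.
  rewrite /= ab !permM /t.
  case: (tpermP i j a) => [ea|ea|/eqP na1 /eqP na2];
    case: (tpermP i j b) => [eb|eb|/eqP nb1 /eqP nb2];
    move: ab wab; rewrite ?ea ?eb; lia.
exists (i, j); first by rewrite inE /= ij !permM tpermL tpermR.
apply/imsetP => -[[a b]]; rewrite inE /= /phi => /andP[ab wab] /=.
case: ifP => _ [ei ej].
  have ea : a = j by apply: (@perm_inj _ t); rewrite -ei tpermR.
  have eb : b = i by apply: (@perm_inj _ t); rewrite -ej tpermL.
  by move: ab; rewrite ea eb; lia.
by move: wab; rewrite -ei -ej; lia.
Qed.

(** Exchanging two adjacent values affects no comparison but their own. *)
Lemma inversions_simple w s : s \in simple_transpositions n ->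
  #|inversions (w * s)| <= #|inversions w|.+1.
Proof.
rewrite inE => /existsP[c /existsP[d /andP[/eqP dc /eqP->]]].
set p := (w^-1 c, w^-1 d).
suff sub : inversions (w * tperm c d) \subset p |: inversions w.
  apply: leq_trans (subset_leq_card sub) _.
  by rewrite cardsU1; case: (p \notin _).
apply/subsetP => -[a b]; rewrite !inE /= !permM => /andP[ab].
rewrite ab /=.
have wab : w a != w b :> nat.
  by apply/eqP => /val_inj/perm_inj e; move: ab; rewrite e ltnn.
case: (tpermP c d (w b)) => [eb|eb|/eqP nb1 /eqP nb2];
  case: (tpermP c d (w a)) => [ea|ea|/eqP na1 /eqP na2];
  rewrite ?ea ?eb; move: wab; rewrite ?ea ?eb; try lia.
move=> _ _; apply/orP; left; by rewrite xpair_eqE -ea -eb !permK !eqxx.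
Qed.

Lemma inversions1 : inversions 1 = set0.
Proof. by apply/setP => -[a b]; rewrite !inE !perm1 /=; lia. Qed.

Lemma inversions_word w (c : seq 'S_n) :
  all (mem (simple_transpositions n)) c ->
  #|inversions (w * \prod_(s <- c) s)| <= #|inversions w| + size c.
Proof.
elim: c w => [|s c IH] w /=; first by rewrite big_nil mulg1 addn0.
case/andP => sS cS; rewrite big_cons mulgA.
apply: leq_trans (IH _ cS) _.
have sle : #|inversions (w * s)| <= #|inversions w|.+1 := inversions_simple w sS.
by rewrite addnS -addSn leq_add2r.
Qed.

(** Otherwise the inverse of [w] is increasing, hence the identity.  The inverse
    appears because right multiplication by a simple transposition exchanges two
    consecutive values, whose positions must be compared. *)
Lemma descent_exists w : w != 1 ->
  exists c d : 'I_n, d = c.+1 :> nat /\ w^-1 d < w^-1 c.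
Proof.
move=> w1.
have [/existsP[c /existsP[d /andP[/eqP dc lt]]]|no] :=
    boolP [exists c : 'I_n, exists d : 'I_n, (d == c.+1 :> nat) && (w^-1 d < w^-1 c)].
  by exists c, d.
case/negP: w1.
have incr (c d : 'I_n) : d = c.+1 :> nat -> w^-1 c < w^-1 d.
  move=> dc; move: no; rewrite negb_exists => /forallP/(_ c).
  rewrite negb_exists => /forallP/(_ d); rewrite dc eqxx /= -leqNgt leq_eqVlt.
  by case/orP => // /eqP/val_inj/perm_inj e; move: dc; rewrite e; lia.
(* An increasing self-map is at least the identity, so all its values are
   forced, counting down from the top. *)
have ge (m : nat) (c : 'I_n) : c = m :> nat -> m <= w^-1 c.
  elim: m c => // m IH c cm.
  have mn : m < n by have := ltn_ord c; lia.
  by have := IH (Ordinal mn) erefl; have := @incr (Ordinal mn) c cm; lia.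
have le (m : nat) (c : 'I_n) : m + c = n.-1 -> w^-1 c <= c.
  elim: m c => [|m IH] c cm; first by have := ltn_ord (w^-1 c); lia.
  have mn : c.+1 < n by lia.
  have := IH (Ordinal mn); have := @incr c (Ordinal mn) erefl.
  by rewrite /= => h1 h2; have := h2 ltac:(lia); lia.
apply/eqP/permP => i; rewrite perm1; apply: (@perm_inj _ w^-1); rewrite permK.
apply: val_inj; apply/eqP; rewrite /= eqn_leq ge //=.
by apply: (le (n.-1 - i)); have := ltn_ord i; lia.
Qed.

Lemma coxeter_length_word w : has_word w (coxeter_length w).
Proof. by rewrite /coxeter_length; case: ex_minnP. Qed.

Lemma coxeter_length_min w k : has_word w k -> coxeter_length w <= k.
Proof. by rewrite /coxeter_length; case: ex_minnP => m _; apply. Qed.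

Lemma coxeter_length_simple w s : s \in simple_transpositions n ->
  coxeter_length (w * s) <= (coxeter_length w).+1.
Proof.
move=> sS; apply: coxeter_length_min.
have /existsP[c /andP[cS /eqP wc]] := coxeter_length_word w.
apply/existsP; exists [tuple of rcons c s].
by rewrite all_rcons cS /= sS andbT -cats1 big_cat big_seq1; apply/eqP; congr (_ * _).
Qed.

Lemma coxeter_lengthE w : coxeter_length w = #|inversions w|.
Proof.
apply/eqP; rewrite eqn_leq; apply/andP; split; last first.
  have /existsP[c /andP[cS /eqP {1}->]] := coxeter_length_word w.
  rewrite -[X in inversions X]mul1g (leq_trans (inversions_word _ cS)) //.
  by rewrite inversions1 cards0 size_tuple.
have [m] := ubnP #|inversions w|; elim: m w => // m IH w wm.
have [->|/descent_exists[c [d [dc lt]]]] := eqVneq w 1.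
  apply: leq_trans (leq0n _); apply: coxeter_length_min; apply/existsP.
  by exists [tuple]; rewrite /= big_nil.
set s := tperm c d.
have sS : s \in simple_transpositions n.
  by rewrite inE; apply/existsP; exists c; apply/existsP; exists d; rewrite dc !eqxx.
have wsK : w * s * s = w by rewrite -mulgA tperm2 mulg1.
have inv_lt : #|inversions (w * s)| < #|inversions w|.
  have := @inversions_tperm (w * s) _ _ lt.
  rewrite tperm_mul_perm !permM !permKV tpermL tpermR => /(_ ltac:(lia)).
  by rewrite wsK.
rewrite -[X in coxeter_length X]wsK (leq_trans (coxeter_length_simple _ sS)) //.
by rewrite (leq_ltn_trans (IH _ _) inv_lt) // (leq_trans inv_lt).
Qed.

End Inversions.

(** * Bruhat steps and rank functions *)

Section BruhatRank.
Variable n : nat.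
Implicit Types (u v w : 'S_n) (i j : 'I_n).
Local Open Scope group_scope.

Lemma reflectionsP (r : 'S_n) :
  reflect (exists i j, i < j /\ r = tperm i j) (r \in reflections n).
Proof.
apply: (iffP imset2P) => [[s w + _ ->]|[i [j [ij ->]]]].
  rewrite inE => /existsP[c /existsP[d /andP[/eqP dc /eqP->]]]; rewrite tpermJ.
  case: (ltngtP (w c) (w d)) => [lt|lt|/val_inj/perm_inj e].
  - by exists (w c), (w d).
  - by exists (w d), (w c); rewrite tpermC.
  - by move: dc; rewrite e; lia.
have cn : i.+1 < n by have := ltn_ord j; lia.
pose c := Ordinal cn.
exists (tperm i c) (tperm c j); rewrite ?inE //.
  by apply/existsP; exists i; apply/existsP; exists c; rewrite !eqxx.
by rewrite tpermJ tpermL tpermD //; apply/eqP => /(congr1 val) /=; lia.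
Qed.

(** Which of the two directions increases the length is decided by
    [inversions_tperm], applied to [u] or to the exchanged permutation. *)
Lemma bruhat_stepP u v :
  reflect (exists i j, [/\ i < j, u i < u j & v = tperm i j * u]) (bruhat_step u v).
Proof.
rewrite /bruhat_step !coxeter_lengthE.
apply: (iffP andP) => [[/existsP[r /andP[/reflectionsP[a [b [ab ->]]] /eqP->]] lt]|].
  have vE : u * tperm a b = tperm (u^-1 a) (u^-1 b) * u.
    by rewrite tperm_mul_perm !permKV.
  case: (ltngtP (u^-1 a) (u^-1 b)) => [ij|ij|/val_inj/perm_inj e]; last first.
  - by move: ab; rewrite e ltnn.
  - have := @inversions_tperm _ (u * tperm a b) _ _ ij.
    rewrite tperm_mul_perm !permM !permKV tpermL tpermR => /(_ ab).
    by rewrite -mulgA tperm2 mulg1 => /(ltn_trans lt); rewrite ltnn.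
  - by exists (u^-1 a), (u^-1 b); rewrite !permKV.
move=> [i [j [ij uij ->]]]; split; last exact: inversions_tperm.
apply/existsP; exists (tperm (u i) (u j)).
rewrite tperm_mul_perm eqxx andbT.
by apply/reflectionsP; exists (u i), (u j).
Qed.

Definition rank w (k m : nat) : nat := \sum_(a < n) ((a < k) && (w a < m)).

Lemma rank_tperm w i j k m : i < j -> w i < w j ->
  rank w k m = rank (tperm i j * w) k m + ((i < k <= j) && (w i < m <= w j)).
Proof.
move=> ij wij; have ji : j != i by apply/eqP => e; move: ij; rewrite e ltnn.
rewrite /rank (bigD1 i) //= (bigD1 j) //= [in RHS](bigD1 i) //= [in RHS](bigD1 j) //=.
rewrite !permM tpermL tpermR.
have -> : \sum_(a < n | (a != i) && (a != j)) ((a < k) && ((tperm i j * w)%g a < m))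
        = \sum_(a < n | (a != i) && (a != j)) ((a < k) && (w a < m)).
  by apply: eq_bigr => a /andP[ai aj]; rewrite permM tpermD // eq_sym.
by move: (\sum_(a < n | _) _) => S; lia.
Qed.

Lemma rank_split w k m m' : m <= m' ->
  rank w k m' = rank w k m + \sum_(a < n) ((a < k) && (m <= w a < m')).
Proof. by move=> le; rewrite /rank -big_split; apply: eq_bigr => a _ /=; lia. Qed.

(** Let [j] be the first position where [u] and [v] differ; comparing ranks there
    gives [u j < v j].  Exchange [u j] with the first later value [u k] of [u]
    such that [u j < u k <= v j].  By the choice of [k], the values of [u] in
    this range at positions before [k] all stand before [j], where [u] and [v]
    agree, while [v] also takes the value [v j] at [j]: this is the slack that
    allows the ranks to drop by one. *)
Lemma rank_le_step u v : (forall k m, rank v k m <= rank u k m) -> u != v ->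
  exists2 u', bruhat_step u u' & forall k m, rank v k m <= rank u' k m.
Proof.
move=> le_vu neq_uv.
have [j0 j0P] : exists j, u j != v j.
  apply/existsP; rewrite -negb_forall; apply: contra neq_uv => /forallP e.
  by apply/eqP/permP => i; apply/eqP.
case: (@arg_minnP _ _ (fun j => u j != v j) (fun j => j : nat) j0P) => j /= uvj j_min.
have agree (a : 'I_n) : a < j -> u a = v a.
  move=> aj; apply/eqP; apply: contraLR aj => /j_min; by rewrite -leqNgt.
have uj_lt : u j < v j.
  have := le_vu j.+1 (v j).+1; rewrite /rank.
  rewrite (bigD1 j) //= [X in _ <= X](bigD1 j) //= !ltnS !leqnn /=.
  have -> : \sum_(a < n | a != j) ((a <= j) && (v a <= v j))
          = \sum_(a < n | a != j) ((a <= j) && (u a <= v j)).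
    apply: eq_bigr => a aj; case: (ltngtP a j) => [/agree->//|//|/val_inj e].
    by rewrite e eqxx in aj.
  by rewrite leq_add2r; have : (u j != v j :> nat) := uvj; lia.
have k0P : (j < u^-1 (v j)) && (u j < u (u^-1 (v j)) <= v j).
  rewrite permKV uj_lt leqnn !andbT ltnNge leq_eqVlt; apply/negP.
  case/orP => [/eqP/val_inj e|lt].
    by move: uj_lt; rewrite -{1}e permKV ltnn.
  have := agree _ lt; rewrite permKV => /perm_inj e.
  by move: lt; rewrite -e ltnn.
case: (@arg_minnP _ _ (fun k : 'I_n => (j < k) && (u j < u k <= v j))
         (fun k => k : nat) k0P) => k /and3P[jk ujk ukj] k_min.
exists (tperm j k * u); first by apply/bruhat_stepP; exists j, k.
move=> p q; have := rank_tperm p q jk ujk.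
case: (boolP (_ && _)) => [/andP[/andP[jp pk] /andP[uq qu]]|_]; last first.
  by rewrite addn0 => <-.
rewrite addn1 => rE; rewrite -ltnS -rE.
have qv : q <= (v j).+1 by lia.
have := le_vu p (v j).+1; rewrite (rank_split v p qv) (rank_split u p qv).
suff : \sum_(a < n) ((a < p) && (q <= u a < (v j).+1))
     < \sum_(a < n) ((a < p) && (q <= v a < (v j).+1)) by lia.
rewrite (bigD1 j) //= [X in _ < X](bigD1 j) //= jp.
have -> : (q <= u j < (v j).+1) = false by lia.
have -> : (q <= v j < (v j).+1) by lia.
rewrite add0n add1n ltnS; apply: leq_sum => a aj.
case: (ltngtP a j) => [/agree->//|ja|/val_inj e]; last by rewrite e eqxx in aj.
case: (boolP (_ && _)) => // /and3P[ap qa av].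
by have := k_min a; rewrite ja /= => /(_ ltac:(lia)); lia.
Qed.

(** The rank-matrix criterion for the Bruhat order. *)
Lemma bruhat_le_rank u v :
  bruhat_le u v <-> forall k m, rank v k m <= rank u k m.
Proof.
split=> [/connectP[p]|].
  elim: p u => [|w p IH] u /=; first by move=> _ -> k m.
  case/andP => /bruhat_stepP[i [j [ij uij wE]]] /IH h /h le k m.
  by apply: leq_trans (le k m) _; rewrite (rank_tperm k m ij uij) wE leq_addr.
(* The length increases at every step and is at most the number of pairs. *)
have [N N_max] : exists N, forall w, coxeter_length w <= N.
  by exists #|{: 'I_n * 'I_n}| => w; rewrite coxeter_lengthE max_card.
have [d] := ubnP (N - coxeter_length u).
elim: d u => // d IH u ud le.
have [->|neq] := eqVneq u v; first exact: connect0.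
have [u' st le'] := rank_le_step le neq.
apply: connect_trans (connect1 st) _; apply: IH le'.
by have /andP[_ lt] := st; have := N_max u'; lia.
Qed.

End BruhatRank.

(** * The order on tableaux in terms of ranks *)

Section TableauRank.
Variables (l n : nat) (theta : 'I_l -> int) (lam : one_column l n).
Implicit Types t s : tableau lam.
Local Open Scope fset_scope.

Notation dom := (dominant_tableau theta lam).

Lemma initial_setS t (i : 'I_n) :
  initial_set t i.+1 = val (t i) |` initial_set t i.
Proof.
apply/fsetP => x; rewrite in_fset1U; apply/idP/orP.
  case/imfsetP => /= j; rewrite inE ltnS leq_eqVlt => /orP[/eqP/val_inj-> ->|ji ->].
    by left.
  by right; apply/imfsetP; exists j.
case=> [/eqP->|/imfsetP[/= j ji ->]]; apply/imfsetP; first by exists i; rewrite ?inE /=.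
by exists j => //; rewrite inE /= ltnW.
Qed.

Lemma dominant_initial_diagram (k : nat) : k <= n ->
  is_diagram (initial_set dom k).
Proof.
case: k => [|k] kn.
  apply/is_diagramP; exists (fun=> 0); apply/fsetP => x; rewrite mem_diagram.
  by rewrite [RHS](_ : _ = false); [apply/negP => /imfsetP[]|lia].
have /forallP/(_ (Ordinal kn))/andP[/andP[_]] := dominant_tableauP theta lam.
by rewrite -initial_setS.
Qed.

(** The column of the [j]-th entry contains, in its row or an earlier one, a
    node that is addable at stage [i]: the [j]-th entry is not placed yet and
    the placed nodes form a diagram.  Residues decrease down a column, so this
    node is at least as large as the [j]-th entry, while it is at most the
    [i]-th entry, the largest addable node. *)
Lemma dominant_decreasing (i j : 'I_n) : i < j ->
  node_lt theta (val (dom j)) (val (dom i)).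
Proof.
move=> ij.
have /is_diagramP[a aE] := dominant_initial_diagram (ltnW (ltn_ord i)).
have /forallP/(_ i)/andP[_ /forallP mx] := dominant_tableauP theta lam.
have jA : val (dom j) \notin initial_set dom i.
  apply/negP => /imfsetP[/= j' j'i /val_inj/(@tableau_inj _ _ _ dom) e].
  by move: j'i; rewrite inE -e; lia.
have := valP (dom j); move: jA; rewrite aE !mem_diagram.
set x := val (dom j) => xA /andP[/andP[x1 xlam] /eqP xc].
pose y : node l := ((a x.2).+1, 1, x.2).
have yD : y \in diagram lam by rewrite mem_diagram /= andbT; lia.
have := mx [` yD]; rewrite aE /=.
have -> : addable (diagram a) y.
  rewrite /addable mem_diagram /= ltnn /=.
  apply/is_diagramP; exists (fun m => (a m + (m == x.2))%N).
  apply/fsetP => -[[r c] m]; rewrite in_fset1U !mem_diagram /= !xpair_eqE.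
  by case: (eqVneq m x.2) => [->|_]; lia.
have xy : (x == y) || node_lt theta x y.
  rewrite /node_lt /residue /= xc.
  have := xA; rewrite xc eqxx andbT x1 /= -ltnNge leq_eqVlt.
  case/orP => [/eqP e|]; last lia.
  apply/orP; left; rewrite /y e; move: xc.
  by case: (x) => [[r c] m] /= ->.
have ne : val (dom i) != x.
  by apply/eqP => /val_inj/(@tableau_inj _ _ _ dom) e; move: ij; rewrite e ltnn.
rewrite implyTb => /orP[/eqP yi|yi].
  by case/orP: xy => [/eqP e|]; [move: ne; rewrite -yi e eqxx|rewrite -yi].
by case/orP: xy => [/eqP->//|xy]; apply: node_lt_trans xy yi.
Qed.

Lemma dominant_node_lt (i j : 'I_n) :
  node_lt theta (val (dom j)) (val (dom i)) = (i < j).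
Proof.
case: (ltngtP i j) => [/dominant_decreasing//|/dominant_decreasing lt|/val_inj->].
  by apply/negP => /(node_lt_trans lt); rewrite node_lt_irr.
by rewrite node_lt_irr.
Qed.

Lemma card_initial_set_above t (k : nat) (x0 : node l) :
  #|` [fset x in initial_set t k | node_lt theta x0 x]|
  = \sum_(a < n) ((a < k) && node_lt theta x0 (val (t a))).
Proof.
pose P := [pred a : 'I_n | (a < k) && node_lt theta x0 (val (t a))].
have -> : [fset x in initial_set t k | node_lt theta x0 x] =
          [fset val (t a) | a in P].
  apply/fsetP => x; rewrite !inE /=; apply/andP/imfsetP.
    case=> /imfsetP[/= a ak ->] lt; exists a => //=.
    by rewrite !inE /= lt andbT.
  case=> /= a; rewrite !inE /= => /andP[ak lt] ->; split=> //.
  by apply/imfsetP; exists a.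
rewrite card_imfset /=; last by move=> a b /val_inj/(@tableau_inj _ _ _ t).
rewrite -cardE -sum1_card big_mkcond /=.
by apply: eq_bigr => a _; rewrite !inE; case: (_ && _).
Qed.

(** The nodes above an arbitrary node, which need not lie in the diagram, are
    an initial segment of the dominant tableau. *)
Lemma nodes_above_initial (x0 : node l) : exists m : nat,
  forall i : 'I_n, node_lt theta x0 (val (dom i)) = (i < m).
Proof.
have [[m mn]|] := pickP [pred i : 'I_n | ~~ node_lt theta x0 (val (dom i))]; last first.
  by move=> h; exists n => i; rewrite ltn_ord; have /negbFE := h i.
move=> /= h; case: (@arg_minnP _ _ (fun i : 'I_n => ~~ node_lt theta x0 (val (dom i)))
  (fun i : 'I_n => i : nat) h) => j jP j_min; exists j => i.
apply/idP/idP => [lt|]; last first.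
  by apply: contraLR => /j_min; rewrite -leqNgt.
rewrite ltnNge leq_eqVlt; apply: contra jP => /orP[/eqP/val_inj->//|ji].
exact: node_lt_trans lt (dominant_decreasing ji).
Qed.

Lemma tableau_le_rank s t : tableau_le theta s t <->
  forall k m, rank (tableau_perm theta s) k m <= rank (tableau_perm theta t) k m.
Proof.
split=> le k => [m|kn x0]; last first.
  have [m mP] := nodes_above_initial x0.
  rewrite !card_initial_set_above; have := le k m; rewrite /rank.
  by congr (_ <= _); apply: eq_bigr => a _; rewrite -(tableau_permP theta) mP.
wlog kn : k / k <= n => [H|].
  (* All positions are smaller than [n], so the ranks at [k > n] and [n] agree. *)
  have [/H//|nk] := leqP k n; have := H n (leqnn n); congr (_ <= _);
    by apply: eq_bigr => a _; rewrite (leq_trans (ltn_ord a) (ltnW nk)) ltn_ord.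
have [->|k0] := posnP k; first by rewrite /rank big1.
have [mn|nm] := ltnP m n; last first.
  rewrite /rank leq_eqVlt; apply/orP; left; apply/eqP; apply: eq_bigr => a _.
  by rewrite !(leq_trans (ltn_ord _) nm).
have k1n : 1 <= k <= n by rewrite k0.
have := le k k1n (val (dom (Ordinal mn))); rewrite !card_initial_set_above.
have rankE (r : tableau lam) :
    \sum_(a < n) ((a < k) && node_lt theta (val (dom (Ordinal mn))) (val (r a)))
  = rank (tableau_perm theta r) k m.
  by apply: eq_bigr => a _; rewrite -[r a](tableau_permP theta r) dominant_node_lt.
by rewrite !rankE.
Qed.

Lemma eq_tableau_perm s t : tableau_perm theta s = tableau_perm theta t <-> s = t.
Proof.
split=> [e|->//]; apply/val_inj/ffunP => i.
by rewrite -(tableau_permP theta s) e tableau_permP.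
Qed.

End TableauRank.

Theorem theorem4 (l n : nat) (theta : 'I_l -> int) (lam : one_column l n)
    (t s : tableau lam) :
  bruhat_lt (tableau_perm theta s) (tableau_perm theta t)
  <-> tableau_lt theta s t.
Proof.
rewrite /bruhat_lt /tableau_lt; split=> [/andP[/bruhat_le_rank le /eqP ne]|[le ne]].
  by split; [apply/tableau_le_rank|move/(eq_tableau_perm theta)].
apply/andP; split; first by apply/bruhat_le_rank/tableau_le_rank.
by apply/eqP => /eq_tableau_perm.
Qed.
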